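(* Let $P=\{p<q\}$, let $v\in\Omega$, and let $S\in\mathrm{Sam}_P$ be compact and cylindrically stratified. Then the map $$\mathcal P_v:\mathrm{Sam}_P\to\mathrm{Ho}(\mathrm{Diag}_P^{\mathbb R_+})$$ is continuous at $S$ (with respect to the interleaving distance on the target). Even more, if the map $\Omega\to\mathrm{Sam}$, $(v_l,v_u)\mapsto S^{v_l}_{v_u}$, is $K$-Lipschitz in a neighborhood of $v$, then $\mathcal P_v$ is $2(K+1)$-Lipschitz at $S$.
   Context: Fix $\mathbb R^N$ with Euclidean norm. ''Metric'' means symmetric Lawvere metric (value $\infty$ allowed, distinct elements may have distance $0$). For $A\subset\mathbb R^N$, $\alpha\ge0$: $A_\alpha=\{y\mid\exists x\in A:\|x-y\|\le\alpha\}$. $\mathbb R_+=[0,\infty)$ as a poset. $\mathrm{Sam}$ is the set of subsets of $\mathbb R^N$ with Hausdorff distance $d_{\mathrm{Hd}}(\mathbb X,\mathbb X')=\inf\{\alpha>0\mid\mathbb X\subset\mathbb X'_\alpha,\mathbb X'\subset\mathbb X_\alpha\}$. $\mathrm{Sam}_P$ is the set of pairs $(\mathbb X,\mathbb X_p)$ with $\mathbb X_p\subset\mathbb X\subset\mathbb R^N$ and metric $\max\{d_{\mathrm{Hd}}(\mathbb X,\mathbb X'),d_{\mathrm{Hd}}(\mathbb X_p,\mathbb X'_p)\}$. $\Omega=\{v=(v_l,v_u)\mid 0<v_l<v_u<1\}$, with the metric of the maximum norm. For $S=(X,S_p)\in\mathrm{Sam}_P$ put $s(x)=\min\{d(x,S_p),1\}$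 on $X$ ($d(x,\emptyset)=\infty$), $S_{\le a}=s^{-1}[0,a]$, $S^{a}=s^{-1}[a,1]$, $S^a_b=s^{-1}[a,b]$. $\mathrm{Top}$ is the category of $\Delta$-generated spaces. $\mathrm{Diag}_P$ is the category of diagrams of spaces $D_p\leftarrow D_{\{p<q\}}\to D_q$; weak equivalences are morphisms that are weak homotopy equivalences at each entry. $\mathrm{Ho}(\mathrm{Diag}_P^{\mathbb R_+})$ is the localization of $\mathrm{Diag}_P^{\mathbb R_+}$ at natural transformations that are weak equivalences at every $\alpha\in\mathbb R_+$. (It is equivalent, via homotopy links, to the persistent homotopy category $\mathrm{Ho}\,\mathrm{Top}_P^{\mathbb R_+}$ of stratified spaces, compatibly with shifts, and the paper identifies the two.) The persistent stratified homotopy type $\mathcal P_v(S)$ is the functor $\alpha\mapsto\{(S_{\le v_u})_\alpha\hookleftarrow(S^{v_l}_{v_u})_\alpha\hookrightarrow(S^{v_l})_\alpha\}$ with structure maps the inclusions, as an object of $\mathrm{Ho}(\mathrm{Diag}_P^{\mathbb R_+})$. Interleaving distance: for $\varepsilon\ge0$ let $Y_\varepsilon(\alpha)=Y(\alpha+\varepsilon)$; this shift and the natural maps $Y\to Y_\varepsilon$ descend to $\mathrm{Ho}(\mathrm{Diag}_P^{\mathbb R_+})$. $Y,Z$ are $\varepsilon$-interleaved if there are morphisms $f:Y\to Z_\varepsilon$, $g:Z\to Y_\varepsilon$ in the homotopy category with $g_\varepsilon\circ f$ and $f_\varepsilon\circ g$ equal to the natural maps $Y\to Y_{2\varepsilon}$,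 $Z\to Z_{2\varepsilon}$. The distance is the infimum of such $\varepsilon$. A map $f:M\to M'$ of metric spaces is $K$-Lipschitz at $x$ ($K\in[0,\infty)$) if there is $\delta>0$ with $d(f(x),f(y))\le K\,d(x,y)$ for all $y$ with $d(x,y)\le\delta$; it is $K$-Lipschitz if this holds with $\delta=\infty$ at every $x$. Cylindrically stratified for $S=(X,S_p)\in\mathrm{Sam}_P$, viewed as a stratified metric space ($S_p$ closed in $X$, $S_q=X\setminus S_p$, Euclidean metric), means: (i) there are a neighborhood $N$ of $S_p$ in $X$, a space $L$, a map $r:L\to S_p$ and a stratum preserving homeomorphism $N\cong M_r$, where $M_r=L\times(0,1]\sqcup S_p$ is the mapping cylinder of $r$ (with $p$-stratum $S_p$) with the teardrop topology, generated by the open subsets of $L\times(0,1]$ and the preimages of open sets under $M_r\to S_p\times[0,1]$, $(l,t)\mapsto(r(l),t)$, $y\mapsto(y,0)$; (ii) there is a homeomorphism $s^{-1}(0,1)\cong s^{-1}(\tfrac12)\times(0,1)$ commuting with $s$ and the projection to $(0,1)$. *)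

(* Defs.v *)
From HB Require Import structures.
From mathcomp Require Import all_boot all_order all_algebra.
From mathcomp Require Import all_classical all_reals all_analysis.

Set Implicit Arguments.
Unset Strict Implicit.
Unset Printing Implicit Defensive.

Import Order.TTheory GRing.Theory Num.Theory.
Import numFieldNormedType.Exports.

Local Open Scope classical_set_scope.
Local Open Scope ring_scope.

(** Hom-types are setoids: [heq] is the equality of morphisms.  Thus the hom-sets
    of a localization (Gabriel-Zisman) are types of words in arrows and formal
    inverses, and [heq] is the congruence by which they are divided. *)

Record category := Category {
  obj :> Type;
  mor : obj -> obj -> Type;
  heq : forall X Y, mor X Y -> mor X Y -> Prop;
  idmor : forall X, mor X X;
  ccomp : forall X Y Z, mor Y Z -> mor X Y -> mor X Z;
  heq_refl : forall X Y (f : mor X Y), heq f f;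
  heq_sym : forall X Y (f g : mor X Y), heq f g -> heq g f;
  heq_trans : forall X Y (f g h : mor X Y), heq f g -> heq g h -> heq f h;
  comp_heq : forall X Y Z (g g' : mor Y Z) (f f' : mor X Y),
    heq g g' -> heq f f' -> heq (ccomp g f) (ccomp g' f');
  compmA : forall X Y Z T (h : mor Z T) (g : mor Y Z) (f : mor X Y),
    heq (ccomp h (ccomp g f)) (ccomp (ccomp h g) f);
  comp1m : forall X Y (f : mor X Y), heq (ccomp (idmor Y) f) f;
  compm1 : forall X Y (f : mor X Y), heq (ccomp f (idmor X)) f
}.

Arguments mor {c} X Y.
Arguments heq {c X Y} f g.
Arguments idmor {c} X.
Arguments ccomp {c X Y Z} g f.

Record functor (C D : category) := Functor {
  fobj :> C -> D;
  homap : forall X Y : C, mor X Y -> mor (fobj X) (fobj Y);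
  homap_heq : forall (X Y : C) (f g : mor X Y), heq f g -> heq (homap f) (homap g);
  homap1 : forall X : C, heq (homap (idmor X)) (idmor (fobj X));
  homapM : forall (X Y Z : C) (g : mor Y Z) (f : mor X Y),
    heq (homap (ccomp g f)) (ccomp (homap g) (homap f))
}.

Arguments homap {C D} _ {X Y} _.

Record nattrans (C D : category) (F G : functor C D) := NatTrans {
  ncomp :> forall X : C, mor (F X) (G X);
  ncomp_natural : forall (X Y : C) (h : mor X Y),
    heq (ccomp (ncomp Y) (homap F h)) (ccomp (homap G h) (ncomp X))
}.

Section FunctorCategory.
Variables C D : category.

Definition nattrans_heq (F G : functor C D) (a b : nattrans F G) : Prop :=
  forall X, heq (a X) (b X).

Definition nattrans_id (F : functor C D) : nattrans F F.
Proof.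
exists (fun X => idmor (F X)) => X Y h.
exact: heq_trans (comp1m _) (heq_sym (compm1 _)).
Defined.

Definition nattrans_comp (F G H : functor C D) (b : nattrans G H)
  (a : nattrans F G) : nattrans F H.
Proof.
exists (fun X => ccomp (b X) (a X)) => X Y h.
apply: heq_trans (heq_sym (compmA _ _ _)) _.
apply: heq_trans (comp_heq (heq_refl _) (ncomp_natural a h)) _.
apply: heq_trans (compmA _ _ _) _.
apply: heq_trans (comp_heq (ncomp_natural b h) (heq_refl _)) _.
exact: heq_sym (compmA _ _ _).
Defined.

Definition functor_cat : category.
Proof.
exists (functor C D) (@nattrans C D) nattrans_heq nattrans_id nattrans_comp.
- by move=> F G a X; exact: heq_refl.
- by move=> F G a b ab X; exact: heq_sym (ab X).
- by move=> F G a b c ab bc X; exact: heq_trans (ab X) (bc X).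
- by move=> F G H b b' a a' bb' aa' X; exact: comp_heq (bb' X) (aa' X).
- by move=> F G H K c b a X; exact: compmA.
- by move=> F G a X; exact: comp1m.
- by move=> F G a X; exact: compm1.
Defined.

End FunctorCategory.

Definition functor_comp (C D E : category) (G : functor D E) (F : functor C D) :
  functor C E.
Proof.
exists (fun X => G (F X)) (fun X Y h => homap G (homap F h)).
- by move=> X Y f g fg; exact: homap_heq (homap_heq F fg).
- by move=> X; exact: heq_trans (homap_heq G (homap1 F X)) (homap1 G _).
- by move=> X Y Z g f; exact: heq_trans (homap_heq G (homapM F g f)) (homapM G _ _).
Defined.

Definition precomp (C C' D : category) (T : functor C C') :
  functor (functor_cat C' D) (functor_cat C D).
Proof.
exists (fun F : functor C' D => functor_comp F T : functor_cat C D)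
  (fun (F G : functor C' D) (a : nattrans F G) => @NatTrans C D (functor_comp F T) (functor_comp G T)
     (fun X => a (T X)) (fun X Y h => ncomp_natural a (homap T h))).
- by move=> F G a b ab X; exact: ab.
- by move=> F X; exact: heq_refl.
- by move=> F G H b a X; exact: heq_refl.
Defined.

Definition arrow_class (C : category) := forall X Y : C, mor X Y -> Prop.

Section Localization.
Variables (C : category) (W : arrow_class C).

Inductive loc_hom : C -> C -> Type :=
| loc_of X Y (f : mor X Y) : loc_hom X Y
| loc_inv X Y (w : mor X Y) of W w : loc_hom Y X
| loc_comp X Y Z (g : loc_hom Y Z) (f : loc_hom X Y) : loc_hom X Z.

Inductive loc_heq : forall X Y, loc_hom X Y -> loc_hom X Y -> Prop :=
| loc_refl X Y (f : loc_hom X Y) : loc_heq f f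
| loc_sym X Y (f g : loc_hom X Y) : loc_heq f g -> loc_heq g f
| loc_trans X Y (f g h : loc_hom X Y) :
    loc_heq f g -> loc_heq g h -> loc_heq f h
| loc_congr X Y Z (g g' : loc_hom Y Z) (f f' : loc_hom X Y) :
    loc_heq g g' -> loc_heq f f' -> loc_heq (loc_comp g f) (loc_comp g' f')
| loc_assoc X Y Z T (h : loc_hom Z T) (g : loc_hom Y Z) (f : loc_hom X Y) :
    loc_heq (loc_comp h (loc_comp g f)) (loc_comp (loc_comp h g) f)
| loc_idl X Y (f : loc_hom X Y) : loc_heq (loc_comp (loc_of (idmor Y)) f) f
| loc_idr X Y (f : loc_hom X Y) : loc_heq (loc_comp f (loc_of (idmor X))) f
| loc_of_heq X Y (f g : mor X Y) : heq f g -> loc_heq (loc_of f) (loc_of g)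
| loc_of_comp X Y Z (g : mor Y Z) (f : mor X Y) :
    loc_heq (loc_of (ccomp g f)) (loc_comp (loc_of g) (loc_of f))
| loc_invl X Y (w : mor X Y) (Ww : W w) :
    loc_heq (loc_comp (loc_inv Ww) (loc_of w)) (loc_of (idmor X))
| loc_invr X Y (w : mor X Y) (Ww : W w) :
    loc_heq (loc_comp (loc_of w) (loc_inv Ww)) (loc_of (idmor Y)).

Definition localization : category :=
  @Category C loc_hom loc_heq (fun X => loc_of (idmor X)) loc_comp
    loc_refl loc_sym loc_trans loc_congr loc_assoc loc_idl loc_idr.

Definition loc_functor : functor C localization :=
  @Functor C localization (fun X => X) loc_of loc_of_heq
    (fun X => loc_refl _) loc_of_comp.

End Localization.

Section LocalizationMap.
Variables (C D : category) (W : arrow_class C) (V : arrow_class D).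
Variables (F : functor C D).
Hypothesis FW : forall (X Y : C) (w : mor X Y), W w -> V (homap F w).

Fixpoint loc_homap (X Y : C) (f : loc_hom W X Y) : loc_hom V (F X) (F Y) :=
  match f in loc_hom _ X Y return loc_hom V (F X) (F Y) with
  | loc_of _ _ f => loc_of V (homap F f)
  | loc_inv _ _ w Ww => loc_inv (FW Ww)
  | loc_comp _ _ _ g f => loc_comp (loc_homap g) (loc_homap f)
  end.

Lemma loc_homap_heq (X Y : C) (f g : loc_hom W X Y) :
  loc_heq f g -> loc_heq (loc_homap f) (loc_homap g).
Proof.
elim=> {X Y f g} /=.
- by move=> *; exact: loc_refl.
- by move=> X Y f g _; exact: loc_sym.
- by move=> X Y f g h _ + _; exact: loc_trans.
- by move=> X Y Z g g' f f' _ + _; exact: loc_congr.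
- by move=> *; exact: loc_assoc.
- move=> X Y f; apply: loc_trans (loc_idl _).
  by apply: loc_congr (loc_refl _); apply: loc_of_heq; exact: homap1.
- move=> X Y f; apply: loc_trans (loc_idr _).
  by apply: loc_congr (loc_refl _) _; apply: loc_of_heq; exact: homap1.
- by move=> X Y f g fg; apply: loc_of_heq; exact: homap_heq.
- move=> X Y Z g f; apply: loc_trans (loc_of_comp _ _ _).
  by apply: loc_of_heq; exact: homapM.
- move=> X Y w Ww; apply: loc_trans (loc_invl _) _.
  by apply: loc_of_heq; apply: heq_sym; exact: homap1.
- move=> X Y w Ww; apply: loc_trans (loc_invr _) _.
  by apply: loc_of_heq; apply: heq_sym; exact: homap1.
Qed.

Definition localization_map : functor (localization W) (localization V) :=
  @Functor (localization W) (localization V) F loc_homap loc_homap_heq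
    (fun X => loc_of_heq V (homap1 F X)) (fun X Y Z g f => loc_refl _).

End LocalizationMap.

Section DeltaGenerated.
Variable R : realType.

Definition simplex (n : nat) : set 'rV[R]_n.+1 :=
  [set t | (forall i, 0 <= t ord0 i) /\ \sum_i t ord0 i = 1].

(** Opens of the final topology for all singular simplices.  A singular simplex
    is a total function on [R^(n+1)], continuous on (the subspace) [simplex n];
    points outside [simplex n] are isolated in [subspace (simplex n)]. *)
Definition delta_open (T : topologicalType) (U : set T) : Prop :=
  forall n (sigma : subspace (@simplex n) -> T),
    continuous sigma -> open (sigma @^-1` U).

Definition delta_generated (T : topologicalType) : Prop :=
  forall U : set T, delta_open U -> open U.

End DeltaGenerated.

(** The coreflection of [T] in Delta-generated spaces: same points, open sets
    [delta_open]. *)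
Definition delta_top (R : realType) (T : Type) : Type := T.

Section DeltaTopology.
Variables (R : realType) (T : topologicalType).

Let opT : @delta_open R T setT.
Proof. by move=> n s _; rewrite preimage_setT; exact: openT. Qed.

Let opI : setI_closed (@delta_open R T).
Proof.
move=> A B oA oB n s cs; rewrite preimage_setI.
by apply: openI; [exact: oA|exact: oB].
Qed.

Let op_bigU (I : Type) (f : I -> set T) : (forall i, delta_open R (f i)) ->
  delta_open R (\bigcup_i f i).
Proof.
move=> of_ n s cs; rewrite preimage_bigcup.
by apply: bigcup_open => i _; exact: of_.
Qed.

HB.instance Definition _ := Choice.on (delta_top R T).
HB.instance Definition _ :=
  isOpenTopological.Build (delta_top R T) opT opI op_bigU.

Lemma delta_topE (U : set (delta_top R T)) : open U = @delta_open R T U.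
Proof. by []. Qed.

Lemma delta_top_generated : delta_generated R (delta_top R T).
Proof.
move=> U dU; rewrite delta_topE => n s cs; apply: (dU n s).
by apply/continuousP => V; rewrite delta_topE => oV; exact: oV cs.
Qed.

End DeltaTopology.

Lemma delta_top_continuous (R : realType) (T U : topologicalType) (f : T -> U) :
  continuous f -> continuous (f : delta_top R T -> delta_top R U).
Proof.
move=> cf; apply/continuousP => V; rewrite !delta_topE => dV n s cs.
apply: (dV n (f \o s)) => x.
by apply: continuous_comp; [exact: cs|exact: cf].
Qed.

Record dtop (R : realType) := DTop {
  dtop_space :> topologicalType;
  dtop_generated : delta_generated R dtop_space
}.

Definition to_dtop (R : realType) (T : topologicalType) : dtop R :=
  DTop (@delta_top_generated R T).

Section WeakHomotopyEquivalence.
Variable R : realType.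

Definition joined (X : topologicalType) (x y : X) : Prop :=
  exists g : R -> X,
    [/\ {within `[0, 1]%classic, continuous g}, g 0 = x & g 1 = y].

Definition cube (n : nat) : set 'rV[R]_n :=
  [set t | forall i, 0 <= t ord0 i <= 1].

Definition cube_boundary (n : nat) : set 'rV[R]_n :=
  [set t | cube t /\ exists i, t ord0 i = 0 \/ t ord0 i = 1].

(** Representatives of elements of [pi_n(X, x)], and homotopies between them
    relative to the boundary. *)
Definition spheroid (n : nat) (X : topologicalType) (x : X)
    (g : 'rV[R]_n -> X) : Prop :=
  {within @cube n, continuous g} /\ forall t, cube_boundary t -> g t = x.

Definition spheroid_homotopic (n : nat) (X : topologicalType) (x : X)
    (g h : 'rV[R]_n -> X) : Prop :=
  exists H : R * 'rV[R]_n -> X,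
    [/\ {within `[0, 1]%classic `*` @cube n, continuous H},
        forall t, cube t -> H (0, t) = g t,
        forall t, cube t -> H (1, t) = h t
      & forall s t, 0 <= s <= 1 -> cube_boundary t -> H (s, t) = x].

(** Bijectivity of [pi_0(f)] and of [pi_n(f, x)] for all [n >= 1] and all [x],
    spelled out on representatives. *)
Definition weak_homotopy_equivalence (X Y : topologicalType) (f : X -> Y) :
    Prop :=
  [/\ continuous f,
      forall x x', joined (f x) (f x') -> joined x x',
      forall y, exists x, joined (f x) y,
      forall n (x : X) (g h : 'rV[R]_n.+1 -> X), spheroid x g -> spheroid x h ->
        spheroid_homotopic (f x) (f \o g) (f \o h) -> spheroid_homotopic x g h
    & forall n (x : X) (h : 'rV[R]_n.+1 -> Y), spheroid (f x) h ->
        exists2 g, spheroid x g & spheroid_homotopic (f x) (f \o g) h].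

End WeakHomotopyEquivalence.

Section Diagrams.
Variable R : realType.

Record diag := Diag {
  diag_p : dtop R;
  diag_pq : dtop R;
  diag_q : dtop R;
  to_p : continuousType diag_pq diag_p;
  to_q : continuousType diag_pq diag_q
}.

Record diag_hom (D E : diag) := DiagHom {
  at_p : continuousType (diag_p D) (diag_p E);
  at_pq : continuousType (diag_pq D) (diag_pq E);
  at_q : continuousType (diag_q D) (diag_q E);
  at_p_natural : at_p \o to_p D =1 to_p E \o at_pq;
  at_q_natural : at_q \o to_q D =1 to_q E \o at_pq
}.

Arguments at_p_natural {D E} _ _.
Arguments at_q_natural {D E} _ _.

Definition diag_heq (D E : diag) (f g : diag_hom D E) : Prop :=
  [/\ at_p f =1 at_p g, at_pq f =1 at_pq g & at_q f =1 at_q g].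

Definition diag_id (D : diag) : diag_hom D D :=
  @DiagHom D D idfun idfun idfun (fun=> erefl) (fun=> erefl).

Definition diag_comp (D E F : diag) (g : diag_hom E F) (f : diag_hom D E) :
  diag_hom D F.
Proof.
exists (at_p g \o at_p f : continuousType _ _)
  (at_pq g \o at_pq f : continuousType _ _)
  (at_q g \o at_q f : continuousType _ _) => x /=.
- exact: etrans (congr1 (at_p g) (at_p_natural f x)) (at_p_natural g _).
- exact: etrans (congr1 (at_q g) (at_q_natural f x)) (at_q_natural g _).
Defined.

Definition Diag_P : category.
Proof.
exists diag diag_hom diag_heq diag_id diag_comp => //.
- by move=> D E f g [fgp fgpq fgq]; split=> x; symmetry.
- move=> D E f g h [fgp fgpq fgq] [ghp ghpq ghq].
  by split=> x; rewrite (fgp, fgpq, fgq) (ghp, ghpq, ghq).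
- move=> D E F g g' f f' [gp gpq gq] [fp fpq fq].
  by split=> x /=; rewrite (fp, fpq, fq) (gp, gpq, gq).
Defined.

Definition diag_weq : arrow_class Diag_P := fun D E f =>
  [/\ weak_homotopy_equivalence R (at_p f),
      weak_homotopy_equivalence R (at_pq f)
    & weak_homotopy_equivalence R (at_q f)].

End Diagrams.

Definition poset_cat (d : Order.disp_t) (T : porderType d) : category.
Proof.
exists T (fun x y : T => (x <= y)%O) (fun _ _ _ _ => True)
  (fun x => lexx x) (fun x y z yz xy => le_trans xy yz) => //.
Defined.

Section Persistence.
Variable R : realType.

Definition Rplus : category := poset_cat {nonneg R}.

Definition nngD (a b : {nonneg R}) : {nonneg R} :=
  NngNum (addr_ge0 (ge0 a) (ge0 b)).

Lemma nngDE (a b : {nonneg R}) : (nngD a b)%:num = a%:num + b%:num.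
Proof. by []. Qed.

Lemma le_nngD (e a b : {nonneg R}) : (a <= b)%O -> (nngD a e <= nngD b e)%O.
Proof. by rewrite -!num_le !nngDE lerD2r. Qed.

Lemma nngD_ge (e a : {nonneg R}) : (a <= nngD a e)%O.
Proof. by rewrite -num_le nngDE lerDl. Qed.

Lemma nngDA_le (e a : {nonneg R}) : (nngD (nngD a e) e <= nngD a (nngD e e))%O.
Proof. by rewrite -num_le !nngDE addrA. Qed.

Definition translation (e : {nonneg R}) : functor Rplus Rplus :=
  @Functor Rplus Rplus (nngD^~ e) (@le_nngD e)
    (fun _ _ _ _ _ => I) (fun _ => I) (fun _ _ _ _ _ => I).

Variable C : category.

Definition pers : category := functor_cat Rplus C.

Definition pshift (e : {nonneg R}) : functor pers pers :=
  precomp C (translation e).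

Lemma structure_natural (Y : functor Rplus C) (a b a' b' : {nonneg R})
    (ab : (a <= b)%O) (ab' : (a' <= b')%O) (aa' : (a <= a')%O)
    (bb' : (b <= b')%O) :
  heq (ccomp (@homap Rplus C Y b b' bb') (@homap Rplus C Y a b ab))
      (ccomp (@homap Rplus C Y a' b' ab') (@homap Rplus C Y a a' aa')).
Proof.
apply: heq_trans (heq_sym (homapM _ _ _)) _.
by apply: heq_trans (homapM _ _ _); exact: homap_heq.
Qed.

Definition to_shift (e : {nonneg R}) (Y : functor Rplus C) :
    @mor pers Y (pshift e Y) :=
  @NatTrans Rplus C Y (pshift e Y) (fun a => @homap Rplus C Y _ _ (nngD_ge e a))
    (fun a b ab => structure_natural Y _ _ _ _).

(** The canonical identification of [(Y_e)_e] with [Y_{e+e}]: its component at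
    [a] is the structure map for [(a + e) + e <= a + (e + e)]. *)
Definition shift_shift (e : {nonneg R}) (Y : functor Rplus C) :
    @mor pers (pshift e (pshift e Y)) (pshift (nngD e e) Y) :=
  @NatTrans Rplus C (pshift e (pshift e Y)) (pshift (nngD e e) Y)
    (fun a => @homap Rplus C Y _ _ (nngDA_le e a))
    (fun a b ab => structure_natural Y _ _ _ _).

Variable W : arrow_class C.

Definition pers_weq : arrow_class pers := fun Y Z f => forall a, W (f a).

Definition Ho : category := localization pers_weq.

Definition Ho_shift (e : {nonneg R}) : functor Ho Ho :=
  @localization_map pers pers pers_weq pers_weq (pshift e)
    (fun Y Z f Wf a => Wf (nngD a e)).

Definition interleaved (e : {nonneg R}) (Y Z : Ho) : Prop :=
  exists (f : mor Y (Ho_shift e Z)) (g : mor Z (Ho_shift e Y)),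
    heq (ccomp (homap (loc_functor pers_weq) (shift_shift e Y))
          (ccomp (homap (Ho_shift e) g) f))
        (homap (loc_functor pers_weq) (to_shift (nngD e e) Y)) /\
    heq (ccomp (homap (loc_functor pers_weq) (shift_shift e Z))
          (ccomp (homap (Ho_shift e) f) g))
        (homap (loc_functor pers_weq) (to_shift (nngD e e) Z)).

Definition interleaving_dist (Y Z : Ho) : \bar R :=
  ereal_inf [set (e%:num)%:E | e in [set e : {nonneg R} | interleaved e Y Z]].

End Persistence.

Definition HoDiag (R : realType) : category := Ho R (@diag_weq R).

Definition dHoDiag (R : realType) (Y Z : HoDiag R) : \bar R :=
  interleaving_dist Y Z.

Section Metric.
Variables (R : realType) (M M' : Type).
Variables (d : M -> M -> \bar R) (d' : M' -> M' -> \bar R).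

Definition mcontinuous_at (f : M -> M') (x : M) : Prop :=
  forall e : R, 0 < e -> exists2 delta : R, 0 < delta &
    forall y, (d x y < delta%:E)%E -> (d' (f x) (f y) < e%:E)%E.

Definition mlipschitz_at (K : R) (f : M -> M') (x : M) : Prop :=
  exists2 delta : R, 0 < delta &
    forall y, (d x y <= delta%:E)%E -> (d' (f x) (f y) <= K%:E * d x y)%E.

Definition mneighborhood (x : M) (U : set M) : Prop :=
  exists2 delta : R, 0 < delta & forall y, (d x y < delta%:E)%E -> U y.

Definition mlipschitz_on (K : R) (U : set M) (f : M -> M') : Prop :=
  forall x y, U x -> U y -> (d' (f x) (f y) <= K%:E * d x y)%E.

End Metric.

Section Samples.
Variables (R : realType) (N : nat).

(** The library norm of ['rV[R]_N] is the maximum norm; it induces the same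
    topology. *)
Definition enorm (x : 'rV[R]_N) : R := Num.sqrt (\sum_i x ord0 i ^+ 2).

Definition thickening (A : set 'rV[R]_N) (a : R) : set 'rV[R]_N :=
  [set y | exists2 x, A x & enorm (x - y) <= a].

Definition Sam : Type := set 'rV[R]_N.

Definition dHd (X X' : Sam) : \bar R :=
  ereal_inf [set a%:E | a in
    [set a : R | [/\ 0 < a, X `<=` thickening X' a & X' `<=` thickening X a]]].

Record SamP := MkSamP {
  sample : set 'rV[R]_N;
  sample_p : set 'rV[R]_N;
  sample_p_sub : sample_p `<=` sample
}.

Definition dSamP (S S' : SamP) : \bar R :=
  maxe (dHd (sample S) (sample S')) (dHd (sample_p S) (sample_p S')).

Definition dist_to (x : 'rV[R]_N) (A : set 'rV[R]_N) : \bar R :=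
  ereal_inf [set (enorm (x - y))%:E | y in A].

(** The function [s]; the minimum lies in [[0, 1]], hence is finite. *)
Definition strat (S : SamP) (x : 'rV[R]_N) : R :=
  fine (mine (dist_to x (sample_p S)) 1%:E).

Definition strat_preim (S : SamP) (I : set R) : set 'rV[R]_N :=
  [set x | sample S x /\ I (strat S x)].

Definition sublevel (S : SamP) (b : R) := strat_preim S `[0, b]%classic.
Definition superlevel (S : SamP) (a : R) := strat_preim S `[a, 1]%classic.
Definition band (S : SamP) (a b : R) := strat_preim S `[a, b]%classic.

End Samples.

Definition Omega (R : realType) : Type :=
  {v : R * R | [&& 0 < v.1, v.1 < v.2 & v.2 < 1]}.

Definition omega_l (R : realType) (v : Omega R) : R := (val v).1.
Definition omega_u (R : realType) (v : Omega R) : R := (val v).2.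

Definition dOmega (R : realType) (v w : Omega R) : \bar R :=
  (Num.max `|omega_l v - omega_l w| `|omega_u v - omega_u w|)%:E.

Definition set_incl (T : Type) (A B : set T) (AB : A `<=` B) (x : A) : B :=
  exist _ (set_val x) (mem_set (AB _ (set_valP x))).

Lemma set_incl_continuous (T : topologicalType) (A B : set T) (AB : A `<=` B) :
  continuous (set_incl AB).
Proof.
apply/continuousP => _ [U oU <-]; exists U => //.
Qed.

Definition dincl (R : realType) (T : topologicalType) (A B : set T)
    (AB : A `<=` B) : continuousType (to_dtop R A) (to_dtop R B) :=
  mkcts (delta_top_continuous (R := R) (set_incl_continuous (AB := AB))).

Section PersistentType.
Variables (R : realType) (N : nat) (v : Omega R) (S : SamP R N).

Let vl := omega_l v.
Let vu := omega_u v.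

Lemma thickening_le (A : set 'rV[R]_N) (a b : {nonneg R}) :
  (a <= b)%O -> thickening A a%:num `<=` thickening A b%:num.
Proof.
by rewrite -num_le => ab y [x Ax xy]; exists x => //; exact: le_trans ab.
Qed.

Lemma thickening_sub (A B : set 'rV[R]_N) (a : R) :
  A `<=` B -> thickening A a `<=` thickening B a.
Proof. by move=> AB y [x Ax xy]; exists x => //; exact: AB. Qed.

Lemma band_sublevel : band S vl vu `<=` sublevel S vu.
Proof.
move=> x [Xx]; rewrite /= !in_itv/= => /andP[lx xu]; split=> //=.
rewrite in_itv/= xu andbT; apply: le_trans lx.
by case/and3P: (valP v) => /ltW.
Qed.

Lemma band_superlevel : band S vl vu `<=` superlevel S vl.
Proof.
move=> x [Xx]; rewrite /= !in_itv/= => /andP[lx xu]; split=> //=.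
rewrite in_itv/= lx; apply: le_trans xu _.
by case/and3P: (valP v) => _ _ /ltW.
Qed.

(** A subspace of [R^N] need not be Delta-generated (e.g. a Cantor set), so each
    thickening carries the coreflected topology of its subspace topology. *)
Definition persistent_type_obj (a : {nonneg R}) : diag R :=
  @Diag R (to_dtop R (thickening (sublevel S vu) a%:num))
    (to_dtop R (thickening (band S vl vu) a%:num))
    (to_dtop R (thickening (superlevel S vl) a%:num))
    (dincl R (thickening_sub band_sublevel))
    (dincl R (thickening_sub band_superlevel)).

Definition persistent_type_map (a b : {nonneg R}) (ab : (a <= b)%O) :
  diag_hom (persistent_type_obj a) (persistent_type_obj b).
Proof.
exists (dincl R (@thickening_le _ _ _ ab)) (dincl R (@thickening_le _ _ _ ab))
  (dincl R (@thickening_le _ _ _ ab)) => x.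
all: exact/val_inj.
Defined.

Definition persistent_type_functor : functor (Rplus R) (Diag_P R).
Proof.
exists (persistent_type_obj : Rplus R -> Diag_P R) persistent_type_map.
- by move=> a b f g _; split=> x; exact/val_inj.
- by move=> a; split=> x; exact/val_inj.
- by move=> a b c g f; split=> x; exact/val_inj.
Defined.

Definition persistent_type : HoDiag R :=
  loc_functor (pers_weq (@diag_weq R)) persistent_type_functor.

End PersistentType.

Definition homeomorphism (T U : topologicalType) (f : T -> U) : Prop :=
  continuous f /\ exists g : U -> T, [/\ continuous g, cancel f g & cancel g f].

Section MappingCylinder.
Variables (R : realType) (L Y : topologicalType).

Definition mapping_cylinder (r : L -> Y) : Type :=
  (L * (`]0, 1]%classic : set R) + Y)%type.

Variable r : L -> Y.
Local Notation M := (mapping_cylinder r).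

Lemma itv01_incl : `]0, 1]%classic `<=` (`[0, 1]%classic : set R).
Proof. by move=> x; rewrite /= !in_itv/= => /andP[/ltW -> ->]. Qed.

Lemma itv01_0 : (`[0, 1]%classic : set R) 0.
Proof. by rewrite /= in_itv/= lexx ler01. Qed.

Definition cylinder_proj (z : M) : (Y * (`[0, 1]%classic : set R))%type :=
  match z with
  | inl (l, t) => (r l, set_incl itv01_incl t)
  | inr y => (y, exist _ 0 (mem_set itv01_0))
  end.

Definition teardrop_subbase : set (set M) :=
  [set A | (exists2 O : set (L * (`]0, 1]%classic : set R)),
              open O & A = inl @` O) \/
           (exists2 O : set (Y * (`[0, 1]%classic : set R)),
              open O & A = cylinder_proj @^-1` O)].

HB.instance Definition _ := Choice.copy M (L * (`]0, 1]%classic : set R) + Y)%type.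
HB.instance Definition _ :=
  isSubBaseTopological.Build M teardrop_subbase (fun A => A).

End MappingCylinder.

Section CylindricallyStratified.
Variables (R : realType) (N : nat) (S : SamP R N).

Definition cylinder_neighborhood : Prop :=
  exists (Nb : set 'rV[R]_N) (L : topologicalType) (r : L -> sample_p S)
         (h : Nb -> mapping_cylinder R r),
    [/\ Nb `<=` sample S /\
        (exists U, [/\ open U, sample_p S `<=` U & U `&` sample S `<=` Nb]),
        continuous r, homeomorphism h
      & forall x : Nb, sample_p S (set_val x) <-> exists y, h x = inr y].

Definition cylinder_interior : Prop :=
  exists h : strat_preim S `]0, 1[%classic ->
      (strat_preim S [set 2^-1] * (`]0, 1[%classic : set R))%type,
    homeomorphism h /\ forall x, set_val (h x).2 = strat S (set_val x).

Definition cylindrically_stratified : Prop :=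
  [/\ closed [set x : sample S | sample_p S (set_val x)],
      cylinder_neighborhood & cylinder_interior].

End CylindricallyStratified.

(* Main.v *)
Require Import Defs.
From mathcomp Require Import all_boot all_order all_algebra.
From mathcomp Require Import all_classical all_reals all_analysis.
From mathcomp Require Import ring lra.
Import numFieldNormedType.Exports.
Import Order.TTheory GRing.Theory Num.Theory.
Local Open Scope classical_set_scope.
Local Open Scope ring_scope.

Set Implicit Arguments.
Unset Strict Implicit.
Unset Printing Implicit Defensive.

(** The persistent types of two samples are compared through genuine inclusions
    of thickenings.  If each of the three pieces (sublevel, band, superlevel) of [S] lies in the [e]-thickening of the
    corresponding piece of [T] and conversely, the inclusions
    [A_a <= B_(a + e)] form an [e]-interleaving already in the category of
    persistent diagrams, and the localization functor carries it to the homotopy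
    category ([interleaved_localized], [dHoDiag_le]).

    Suppose that [S] and [T] are at distance less than [a].  Then each point of
    one sample has a point of the other within [a] of it, and at such a pair of
    points the two functions [strat] differ by at most [2 * a], one [a] for the
    displacement of the point and one for that of the singular stratum
    ([strat_close]).  Hence the band of [T] is [a]-close to the band of [S] taken
    between levels moved by at most [2 * a], and the only remaining question is
    how far the band of [S] itself moves, in Hausdorff distance, when its two
    levels are moved.  If it moves by at most [r], the pieces of [S] and [T] are
    within [r + a] of each other; the sublevel and the superlevel follow the
    band, since a point which they gain or lose lies in a gained or lost part of it ([pieces_within_close]).

    In the Lipschitz case [r] exceeds [2 * K * a] by as little as desired, and
    [r = (2 * K + 1) * a] gives the total [2 * (K + 1) * a].  In general, [r] can
    be made small by compactness.  Widening the levels is harmless: a point of [S]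
    off the band stays off all slightly wider bands, together with a neighborhood
    ([outer_band_near]).  Narrowing them could lose points, namely plateaus of
    [strat] at one of the two levels; they are excluded by the product structure of
    [strat] over [(0, 1)], which moves any point of the band slightly so as to
    reach a level strictly between the two ([level_moves], [inner_band_near]). *)

(** * Euclidean norm and thickenings *)

Section Euclid.
Variables (R : realType) (N : nat).
Implicit Types (x y z : 'rV[R]_N) (A B C : set 'rV[R]_N).

Lemma enorm_ge0 x : 0 <= enorm x.
Proof. exact: sqrtr_ge0. Qed.

Lemma enorm_sqr x : enorm x ^+ 2 = \sum_i x ord0 i ^+ 2.
Proof. by rewrite sqr_sqrtr // sumr_ge0 // => i _; exact: sqr_ge0. Qed.

Lemma enorm0 : enorm (0 : 'rV[R]_N) = 0.
Proof. by rewrite /enorm big1 ?sqrtr0 // => i _; rewrite mxE expr0n. Qed.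

Lemma enormB x y : enorm (x - y) = enorm (y - x).
Proof.
by congr Num.sqrt; apply: eq_bigr => i _; rewrite !mxE -sqrrN opprB.
Qed.

Lemma enorm_eq0 x : enorm x = 0 -> x = 0.
Proof.
move=> x0; have := enorm_sqr x; rewrite x0 expr0n/= => /esym/eqP.
rewrite psumr_eq0 => [/allP x_eq0|i _]; last exact: sqr_ge0.
apply/rowP => i; apply/eqP; rewrite mxE -sqrf_eq0.
by move: (x_eq0 i (mem_index_enum i)); rewrite ?(ord1 ord0).
Qed.

(** Expand the square of the vector [|y| x - |x| y] and divide by [|x| |y|]. *)
Lemma enorm_cauchy_schwarz x y :
  \sum_i x ord0 i * y ord0 i <= enorm x * enorm y.
Proof.
have [/enorm_eq0 ->|x0] := eqVneq (enorm x) 0.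
  by rewrite enorm0 mul0r big1 // => i _; rewrite mxE mul0r.
have [/enorm_eq0 ->|y0] := eqVneq (enorm y) 0.
  by rewrite enorm0 mulr0 big1 // => i _; rewrite mxE mulr0.
have xy0 : 0 < enorm x * enorm y by rewrite mulr_gt0 // lt0r enorm_ge0 ?x0 ?y0.
rewrite -(ler_pM2l xy0).
have : 0 <= \sum_i (enorm y * x ord0 i - enorm x * y ord0 i) ^+ 2.
  by rewrite sumr_ge0 // => i _; exact: sqr_ge0.
have -> : \sum_i (enorm y * x ord0 i - enorm x * y ord0 i) ^+ 2 =
    enorm y ^+ 2 * (\sum_i x ord0 i ^+ 2) + enorm x ^+ 2 * (\sum_i y ord0 i ^+ 2)
    - 2 * (enorm x * enorm y * \sum_i x ord0 i * y ord0 i).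
  rewrite !mulr_sumr -big_split/= -sumrB; apply: eq_bigr => i _; ring.
rewrite -!enorm_sqr; nra.
Qed.

Lemma enormD x y : enorm (x + y) <= enorm x + enorm y.
Proof.
rewrite -ler_sqr ?nnegrE ?addr_ge0 ?enorm_ge0 //.
rewrite sqrrD !enorm_sqr.
have -> : \sum_i (x + y) ord0 i ^+ 2 = \sum_i x ord0 i ^+ 2 +
    (\sum_i x ord0 i * y ord0 i) *+ 2 + \sum_i y ord0 i ^+ 2.
  rewrite -sumrMnl -!big_split/=; apply: eq_bigr => i _.
  by rewrite mxE sqrrD.
by rewrite lerD2r lerD2l lerMn2r/= enorm_cauchy_schwarz.
Qed.

Lemma enorm_triangle y x z : enorm (x - z) <= enorm (x - y) + enorm (y - z).
Proof. by rewrite -[x - z](subrKA y) enormD. Qed.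

Lemma enorm_continuous : continuous (@enorm R N).
Proof.
move=> x; apply: continuous_comp; last exact: sqrt_continuous.
apply: (continuous_big (op := +%R)) => [z|i _ z]; first exact: add_continuous.
apply: (@continuous_comp _ _ _ (fun y : 'rV[R]_N => y ord0 i)
  (@GRing.exp R ^~ 2)).
  exact: coord_continuous.
exact: exprn_continuous.
Qed.

(** Neighborhoods are those of the maximum norm, so this compares the two norms. *)
Lemma enorm_near x (e : R) : 0 < e -> \forall y \near x, enorm (x - y) < e.
Proof.
move=> e0; have : (fun y => enorm (x - y)) @ x --> enorm (x - x).
  apply: (@continuous_comp _ _ _ (fun y => x - y) (@enorm R N)).
    apply: (@continuousB _ _ _ (cst x) id); first exact: cst_continuous.
    exact: cvg_id.
  exact: enorm_continuous.
rewrite subrr enorm0.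
move=> /cvgrPdist_lt /(_ _ e0); apply: filterS => y.
by rewrite sub0r normrN ger0_norm ?enorm_ge0.
Qed.

Lemma sub_thickening A (a : R) : 0 <= a -> A `<=` thickening A a.
Proof. by move=> a0 x Ax; exists x; rewrite // subrr enorm0. Qed.

Lemma thickening_incr A (a b : R) : a <= b -> thickening A a `<=` thickening A b.
Proof. by move=> ab x [y Ay yx]; exists y => //; exact: le_trans ab. Qed.

Lemma thickening_trans B A C (a b : R) :
  A `<=` thickening B a -> B `<=` thickening C b -> A `<=` thickening C (a + b).
Proof.
move=> AB BC x /AB[y /BC[z Cz zy] yx]; exists z => //.
by apply: le_trans (enorm_triangle y z x) _; rewrite addrC lerD.
Qed.

Lemma dHd_lt A B (a : R) : (dHd A B < a%:E)%E ->
  A `<=` thickening B a /\ B `<=` thickening A a.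
Proof.
move=> /ereal_inf_lt[_ [b [_ AB BA] <-]]; rewrite lte_fin => /ltW ba.
by split; apply: subset_trans (thickening_incr ba).
Qed.

Lemma dHd_ge0 A B : (0 <= dHd A B)%E.
Proof. by apply: le_ereal_inf_tmp => _ [a [/ltW a0 _ _] <-]; rewrite lee_fin. Qed.

End Euclid.

(** * The stratifying function *)

Section Stratification.
Variables (R : realType) (N : nat).
Implicit Types (S T : SamP R N) (x y : 'rV[R]_N).

Lemma dist_to_ge0 x (A : set 'rV[R]_N) : (0 <= dist_to x A)%E.
Proof.
by apply: le_ereal_inf_tmp => _ [y _ <-]; rewrite lee_fin enorm_ge0.
Qed.

Lemma EFin_strat S x : (strat S x)%:E = mine (dist_to x (sample_p S)) 1%:E.
Proof.
rewrite /strat fineK // ge0_fin_numE; first by rewrite gt_min ltry orbT.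
by rewrite le_min dist_to_ge0 lee_fin ler01.
Qed.

Lemma strat_ge0 S x : 0 <= strat S x.
Proof. by rewrite -lee_fin EFin_strat le_min dist_to_ge0 lee_fin ler01. Qed.

Lemma strat_le1 S x : strat S x <= 1.
Proof. by rewrite -lee_fin EFin_strat ge_min lexx orbT. Qed.

(** Below the level 1 the truncation is invisible, and an infimum is less than
    [t] exactly when one of the distances is. *)
Lemma strat_lt S x (t : R) : t <= 1 ->
  strat S x < t <-> exists2 p, sample_p S p & enorm (x - p) < t.
Proof.
move=> t1; rewrite -lte_fin EFin_strat gt_min lte_fin [1 < t]ltNge t1 orbF.
split=> [/ereal_inf_lt[_ [p Sp <-]]|[p Sp xp]]; first by exists p.
by apply: le_lt_trans (ereal_inf_lbound _) _; [exists p|].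
Qed.

(** A point of the singular stratum of [T] that is near [y] is displaced by at
    most [b] into that of [S], and [y] by at most [a] to [x]. *)
Lemma strat_close S T x y (a b : R) : 0 <= a -> 0 <= b ->
  sample_p T `<=` thickening (sample_p S) b -> enorm (x - y) <= a ->
  strat S x <= strat T y + (a + b).
Proof.
move=> a0 b0 TS xy; rewrite leNgt; apply/negP => lt_s.
have s1 := strat_le1 S x.
have t1 : strat S x - (a + b) <= 1 by lra.
have lt_t : strat T y < strat S x - (a + b) by lra.
have [p' /TS[p Sp pp'] yp'] := (strat_lt T y t1).1 lt_t.
suff : strat S x < strat S x by rewrite ltxx.
apply: (strat_lt S x s1).2; exists p => //.
have := enorm_triangle y x p; have := enorm_triangle p' y p.
rewrite (enormB p' p); lra.
Qed.

Lemma strat_near S x (e : R) : 0 < e ->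
  \forall y \near x, `|strat S y - strat S x| < e.
Proof.
move=> e0; have e20 : 0 < e / 2 by rewrite divr_gt0.
have SS := @sub_thickening R N (sample_p S) 0 (lexx 0).
near=> y.
have xy : enorm (x - y) <= e / 2 by apply: ltW; near: y; exact: enorm_near.
have := strat_close (ltW e20) (lexx 0) SS xy.
rewrite enormB in xy.
have := strat_close (ltW e20) (lexx 0) SS xy.
rewrite ltr_norml; lra.
Unshelve. all: by end_near. Qed.

(** Off a closed interval of levels there is room to move the point and to widen
    the interval simultaneously. *)
Lemma strat_notin_near S x (l u : R) : ~~ (l <= strat S x <= u) ->
  \forall y \near x & b \near 0^'+, ~~ (l - b <= strat S y <= u + b).
Proof.
move=> sx.
have [m m0 far] : exists2 m, 0 < m & (strat S x < l - m) || (u + m < strat S x).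
  rewrite negb_and -!ltNge in sx; case/orP: sx => sx.
    by exists ((l - strat S x) / 2); [lra|apply/orP; left; lra].
  by exists ((strat S x - u) / 2); [lra|apply/orP; right; lra].
have m20 : 0 < m / 2 by lra.
exists ([set y | `|strat S y - strat S x| < m / 2], [set b | b < m / 2]).
  by split; [exact: strat_near|exact: nbhs_right_lt].
move=> [y b] [/=]; rewrite ltr_norml; lra.
Qed.

End Stratification.

(** * Interleavings by inclusions *)

Section Localized.
Variables (R : realType) (C : category) (W : arrow_class C).

(** The shift on the localization is induced by the shift, so both composites are
    words consisting of arrows only, which can be composed before localizing. *)
Lemma interleaved_localized (e : {nonneg R}) (Y Z : pers R C)
    (f : mor Y (pshift C e Z)) (g : mor Z (pshift C e Y)) :
  heq (ccomp (shift_shift e Y) (ccomp (homap (pshift C e) g) f))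
      (to_shift (nngD e e) Y) ->
  heq (ccomp (shift_shift e Z) (ccomp (homap (pshift C e) f) g))
      (to_shift (nngD e e) Z) ->
  interleaved (W := W) e (loc_functor (pers_weq W) Y)
    (loc_functor (pers_weq W) Z).
Proof.
have loc_of3 (A B D E : pers R C) (c : mor D E) (b : mor B D) (a : mor A B)
    (d : mor A E) : heq (ccomp c (ccomp b a)) d ->
    loc_heq (loc_comp (loc_of (pers_weq W) c)
      (loc_comp (loc_of (pers_weq W) b) (loc_of (pers_weq W) a)))
      (loc_of (pers_weq W) d).
  move=> cbad; apply: loc_trans (loc_of_heq _ cbad).
  apply: loc_sym; apply: loc_trans (loc_of_comp _ _ _) _.
  exact: loc_congr (loc_refl _) (loc_of_comp _ _ _).
move=> fg gf; exists (loc_of _ f), (loc_of _ g).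
by split; exact: loc_of3.
Qed.

End Localized.

Section StrictInterleaving.
Variables (R : realType) (N : nat) (v : Omega R).
Implicit Types (S T : SamP R N) (e : {nonneg R}).

(** One half of a Hausdorff bound, for all three pieces at once: each half yields
    one of the two maps of an interleaving. *)
Definition pieces_within S T (e : R) : Prop :=
  [/\ sublevel S (omega_u v) `<=` thickening (sublevel T (omega_u v)) e,
      band S (omega_l v) (omega_u v) `<=`
        thickening (band T (omega_l v) (omega_u v)) e
    & superlevel S (omega_l v) `<=` thickening (superlevel T (omega_l v)) e].

Lemma thickening_shift (A B : set 'rV[R]_N) (e a : {nonneg R}) :
  A `<=` thickening B e%:num ->
  thickening A a%:num `<=` thickening B (nngD a e)%:num.
Proof. exact: (@thickening_trans R N A). Qed.

Definition thickened_incl S T e (ST : pieces_within S T e%:num) (a : {nonneg R}) :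
  diag_hom (persistent_type_obj v S a) (persistent_type_obj v T (nngD a e)).
Proof.
exists (dincl R (thickening_shift (a := a) (let: And3 h _ _ := ST in h)))
  (dincl R (thickening_shift (a := a) (let: And3 _ h _ := ST in h)))
  (dincl R (thickening_shift (a := a) (let: And3 _ _ h := ST in h))) => x.
all: exact/val_inj.
Defined.

Definition interleaving_map S T e (ST : pieces_within S T e%:num) :
  @mor (pers R (Diag_P R)) (persistent_type_functor v S)
    (@pshift R (Diag_P R) e (persistent_type_functor v T)).
Proof.
apply: (@NatTrans (Rplus R) (Diag_P R) (persistent_type_functor v S)
  (@pshift R (Diag_P R) e (persistent_type_functor v T)) (thickened_incl ST)).
move=> a b ab; by split=> x; exact/val_inj.
Defined.

Lemma interleaved_of_pieces S T e :
  pieces_within S T e%:num -> pieces_within T S e%:num ->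
  interleaved (W := @diag_weq R) e (persistent_type v S) (persistent_type v T).
Proof.
move=> ST TS; apply: (@interleaved_localized _ _ (@diag_weq R) _ _ _
  (interleaving_map ST) (interleaving_map TS)).
all: by move=> a; split=> x; exact/val_inj.
Qed.

Lemma dHoDiag_le S T (e : R) : 0 <= e ->
  pieces_within S T e -> pieces_within T S e ->
  (dHoDiag (persistent_type v S) (persistent_type v T) <= e%:E)%E.
Proof.
move=> e0 ST TS; apply: ereal_inf_lbound.
by exists (NngNum e0) => //; exact: interleaved_of_pieces.
Qed.

End StrictInterleaving.

(** * Pieces of nearby samples *)

Section Closeness.
Variables (R : realType) (N : nat) (v : Omega R).
Local Notation vl := (omega_l v).
Local Notation vu := (omega_u v).
Implicit Types (S T : SamP R N).

Lemma omegaP : [/\ 0 < vl, vl < vu & vu < 1].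
Proof. by apply/and3P; exact: (valP v). Qed.

Lemma dSamP_lt S T (a : R) : (dSamP S T < a%:E)%E ->
  [/\ sample S `<=` thickening (sample T) a,
      sample T `<=` thickening (sample S) a,
      sample_p S `<=` thickening (sample_p T) a
    & sample_p T `<=` thickening (sample_p S) a].
Proof. by rewrite gt_max => /andP[/dHd_lt[? ?] /dHd_lt[? ?]]. Qed.

Lemma dSamP_sym S T : dSamP S T = dSamP T S.
Proof.
by congr maxe; congr ereal_inf; congr image; apply/seteqP; split=> a [].
Qed.

(** Passing to a point of the nearby sample [T] changes the level by at most
    [2 * a]. *)
Lemma strat_preim_thickening S T (a : R) (I J : set R) :
  (dSamP S T < a%:E)%E ->
  (forall s t, 0 <= t <= 1 -> `|s - t| <= 2 * a -> I s -> J t) ->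
  strat_preim S I `<=` thickening (strat_preim T J) a.
Proof.
move=> /[dup] ST /dSamP_lt[XY _ SpTp TpSp] IJ x [Xx Ix].
have [y Yy yx] := XY x Xx.
have a0 : 0 <= a := le_trans (enorm_ge0 _) yx.
exists y => //; split=> //; apply: IJ Ix; first by rewrite strat_ge0 strat_le1.
have := strat_close a0 a0 SpTp yx; rewrite enormB in yx.
have := strat_close a0 a0 TpSp yx; rewrite ler_norml; lra.
Qed.

(** The levels of [S] are moved by [b >= 2 * a] to compensate for the change of
    levels between [S] and [T], and then moved back at the cost [r].  A point of
    the wider sublevel that is not in the sublevel is in the wider band, and a
    point of the sublevel that is not in the narrower one is in the band, as
    [b <= vu - vl]; so the two assumptions on bands suffice. *)
Lemma pieces_within_close S T (a b r : R) :
  0 <= r -> 0 < a -> 2 * a <= b -> 2 * b <= vu - vl ->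
  (dSamP S T < a%:E)%E ->
  band S (vl - b) (vu + b) `<=` thickening (band S vl vu) r ->
  band S vl vu `<=` thickening (band S (vl + b) (vu - b)) r ->
  pieces_within v S T (r + a) /\ pieces_within v T S (r + a).
Proof.
move=> r0 a0 ab bv ST outer inner.
have [vl0 vlu vu1] := omegaP.
have TS : (dSamP T S < a%:E)%E by rewrite dSamP_sym.
split; split.
(* From [S] to [T]: narrow the levels within [S] first, then pass to [T]. *)
- apply: (@thickening_trans _ _ (sublevel S (vu - b))).
    move=> x [Xx]; rewrite /= in_itv/= => /andP[s0 su].
    have [le_s|lt_s] := leP (strat S x) (vu - b).
      by apply: sub_thickening => //; split=> //=; rewrite in_itv/= s0.
    have [|y [Yy]] := inner x; first by split=> //=; rewrite in_itv/=; lra.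
    rewrite /= in_itv/= => /andP[_ ?] ?; exists y => //; split=> //=.
    by rewrite in_itv/= strat_ge0.
  apply: strat_preim_thickening ST _ => s t /andP[t0 t1].
  rewrite ler_norml /= !in_itv/=; lra.
- apply: thickening_trans inner _; apply: strat_preim_thickening ST _.
  move=> s t _; rewrite ler_norml /= !in_itv/=; lra.
- apply: (@thickening_trans _ _ (superlevel S (vl + b))).
    move=> x [Xx]; rewrite /= in_itv/= => /andP[s0 su].
    have [le_s|lt_s] := leP (vl + b) (strat S x).
      by apply: sub_thickening => //; split=> //=; rewrite in_itv/= le_s.
    have [|y [Yy]] := inner x; first by split=> //=; rewrite in_itv/=; lra.
    rewrite /= in_itv/= => /andP[? _] ?; exists y => //; split=> //=.
    by rewrite in_itv/= strat_le1 andbT.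
  apply: strat_preim_thickening ST _ => s t /andP[t0 t1].
  rewrite ler_norml /= !in_itv/=; lra.
(* From [T] to [S]: land at wider levels of [S] first, then correct the levels. *)
- rewrite addrC; apply: (@thickening_trans _ _ (sublevel S (vu + b))).
    apply: strat_preim_thickening TS _ => s t /andP[t0 t1].
    rewrite ler_norml /= !in_itv/=; lra.
  move=> x [Xx]; rewrite /= in_itv/= => /andP[s0 su].
  have [le_s|lt_s] := leP (strat S x) vu.
    by apply: sub_thickening => //; split=> //=; rewrite in_itv/= s0.
  have [|y /band_sublevel] := outer x.
    by split=> //=; rewrite in_itv/=; lra.
  by exists y.
- rewrite addrC; apply: thickening_trans outer.
  apply: strat_preim_thickening TS _.
  move=> s t _; rewrite ler_norml /= !in_itv/=; lra.
- rewrite addrC; apply: (@thickening_trans _ _ (superlevel S (vl - b))).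
    apply: strat_preim_thickening TS _ => s t /andP[t0 t1].
    rewrite ler_norml /= !in_itv/=; lra.
  move=> x [Xx]; rewrite /= in_itv/= => /andP[s0 su].
  have [le_s|lt_s] := leP vl (strat S x).
    by apply: sub_thickening => //; split=> //=; rewrite in_itv/= le_s.
  have [|y /band_superlevel] := outer x.
    by split=> //=; rewrite in_itv/=; lra.
  by exists y.
Qed.

End Closeness.

(** * Bands under a change of levels *)

Section BandContinuity.
Variables (R : realType) (N : nat) (S : SamP R N).
Hypothesis S_compact : compact (sample S).

(** Compactness of the sample makes the local statement uniform: near a point of
    the band, that point itself is within [r]; near any other point, slightly
    wider bands are empty. *)
Lemma outer_band_near (l u r : R) : 0 < r ->
  \forall b \near 0^'+, band S (l - b) (u + b) `<=` thickening (band S l u) r.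
Proof.
move=> r0; move/compact_near_coveringP : S_compact => covering.
pose P b x := l - b <= strat S x <= u + b -> thickening (band S l u) r x.
suff : \forall b \near 0^'+, sample S `<=` P b.
  by apply: filterS => b SP x [Xx /=]; rewrite in_itv/=; exact: SP.
apply: covering => x Xx.
have [sx|sx] := boolP (l <= strat S x <= u).
  exists ([set y | enorm (x - y) < r], setT).
    by split; [exact: enorm_near|exact: filterT].
  move=> [y b] [/= xy _] _; exists x; last exact: ltW.
  by split=> //=; rewrite in_itv.
case: (strat_notin_near sx) => -[A B] AB near_AB; exists (A, B) => //.
by move=> yb /near_AB /negP off_band /off_band.
Qed.

Hypothesis S_interior : cylinder_interior S.

(** In the product decomposition of the open levels, change the second coordinate,
    which is the level, and keep the first. *)
Lemma level_moves (x : 'rV[R]_N) (l u r : R) :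
  0 < l -> l < u -> u < 1 -> 0 < r -> band S l u x ->
  exists y, [/\ sample S y, enorm (x - y) < r & l < strat S y < u].
Proof.
move=> l0 lu u1 r0 [Xx]; rewrite /= in_itv/= => /andP[lx xu].
have [h [[_ [g [g_cts hK gK]]] h_strat]] := S_interior.
have sx : strat_preim S `]0, 1[%classic x.
  by split=> //=; rewrite in_itv/=; lra.
pose x' : strat_preim S `]0, 1[%classic := exist _ x (mem_set sx).
have : nbhs (g (h x')) [set y | enorm (x - set_val y) < r].
  have val_cts : continuous (set_val : strat_preim S `]0, 1[%classic -> _).
    exact: initial_continuous.
  rewrite hK; apply: (val_cts x' [set y | enorm (x - y) < r]).
  exact: enorm_near.
move=> /g_cts [[A B] [/= hA hB] AB].
have [V [[W oW WV] Vt VB]] : exists V : set (`]0, 1[%classic : set R),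
  [/\ open V, V (h x').2 & V `<=` B].
  by move: hB; rewrite nbhsE => -[V [oV Vt] VB]; exists V.
have Wt : nbhs (strat S x) W.
  apply: open_nbhs_nbhs; split => //; move: Vt; rewrite -WV /=.
  by rewrite h_strat.
(* The level of [x] may be an end of [[l, u]], so [t] is taken below it unless it
   is the lower end. *)
have [t [Wt' lt tu]] : exists t, [/\ W t, l < t & t < u].
  have [sl|sl] := ltP l (strat S x).
    have : \forall t \near (strat S x)^'-, [/\ W t, l < t & t < u].
      near=> t; split; first by near: t; exact: cvg_within.
        by near: t; exact: nbhs_left_gt.
      by apply: lt_le_trans xu; near: t; exact: nbhs_left_lt.
    exact: filter_ex.
  have : \forall t \near (strat S x)^'+, [/\ W t, l < t & t < u].
    near=> t; split; first by near: t; exact: cvg_within.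
      by apply: le_lt_trans lx _; near: t; exact: nbhs_right_gt.
    by near: t; apply: nbhs_right_lt; lra.
  exact: filter_ex.
have t01 : (`]0, 1[%classic : set R) t by rewrite /= in_itv/=; lra.
pose t' : (`]0, 1[%classic : set R) := exist _ t (mem_set t01).
exists (set_val (g ((h x').1, t'))); split.
- by have [] := set_valP (g ((h x').1, t')).
- apply: (AB ((h x').1, t')); split; first exact: nbhs_singleton.
  by apply: VB; rewrite -WV.
- by rewrite -h_strat gK /= lt tu.
Unshelve. all: by end_near. Qed.

(** Again local by compactness; near a point of the band, the point given by
    [level_moves], whose level is strictly between [l] and [u], belongs to all bands that are only slightly
    narrower. *)
Lemma inner_band_near (l u r : R) : 0 < l -> l < u -> u < 1 -> 0 < r ->
  \forall b \near 0^'+, band S l u `<=` thickening (band S (l + b) (u - b)) r.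
Proof.
move=> l0 lu u1 r0; move/compact_near_coveringP : S_compact => covering.
pose P b x := l <= strat S x <= u -> thickening (band S (l + b) (u - b)) r x.
suff : \forall b \near 0^'+, sample S `<=` P b.
  by apply: filterS => b SP x [Xx /=]; rewrite in_itv/=; exact: SP.
have r20 : 0 < r / 2 by lra.
apply: covering => x Xx.
have [sx|sx] := boolP (l <= strat S x <= u).
  have [|y [Yy xy /andP[ly yu]]] := @level_moves x l u (r / 2) l0 lu u1 r20.
    by split=> //=; rewrite in_itv.
  exists ([set z | enorm (x - z) < r / 2],
      [set b | b < strat S y - l /\ b < u - strat S y]).
    split; first exact: enorm_near.
    by apply: filterI; apply: nbhs_right_lt; rewrite subr_gt0.
  move=> [z b] [/= xz [bl bu]] _; exists y.
    by split=> //=; rewrite in_itv/=; lra.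
  by have := enorm_triangle x y z; rewrite (enormB y x); lra.
case: (strat_notin_near sx) => -[A B] [hA hB] near_AB.
exists (A, B `&` [set b | 0 < b]).
  by split=> //; apply: filterI => //; exact: nbhs_right_gt.
move=> [y b] [/= Ay [By b0]]; rewrite /P.
have /negP off_band := near_AB (y, b) (conj Ay By).
by move=> /andP[ly yu]; case: off_band => /=; lra.
Qed.

End BandContinuity.

(** * Continuity and Lipschitz continuity *)

Section Main.
Variables (R : realType) (N : nat) (v : Omega R) (S : SamP R N).
Local Notation vl := (omega_l v).
Local Notation vu := (omega_u v).

(** The bands of [S] move by at most [e / 3] when their levels move by a small
    [b]; a sample closer than [b / 2] and [e / 3] then has its pieces within
    [2 * e / 3]. *)
Lemma persistent_type_continuous_at :
  compact (sample S) -> cylinder_interior S ->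
  mcontinuous_at (@dSamP R N) (@dHoDiag R) (persistent_type v) S.
Proof.
move=> S_compact S_int e e0.
have [vl0 vlu vu1] := omegaP v.
have e30 : 0 < e / 3 by lra.
near (0 : R)^'+ => b.
have b0 : 0 < b by near: b; exact: nbhs_right_gt.
have outer : band S (vl - b) (vu + b) `<=`
    thickening (band S vl vu) (e / 3).
  by near: b; exact: outer_band_near.
have inner : band S vl vu `<=`
    thickening (band S (vl + b) (vu - b)) (e / 3).
  by near: b; exact: inner_band_near.
have bv : b <= (vu - vl) / 2.
  by near: b; apply: nbhs_right_le; lra.
pose a := Num.min (b / 2) (e / 3).
have a0 : 0 < a by rewrite lt_min e30 divr_gt0.
have ab : 2 * a <= b.
  by have : a <= b / 2 by [rewrite ge_min lexx]; lra.
have ae : a <= e / 3 by rewrite ge_min lexx orbT.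
exists a => // T ST.
have [|SwT TwS] := pieces_within_close (ltW e30) a0 ab _ ST outer inner.
  lra.
apply: (@le_lt_trans _ _ ((e / 3 + a)%:E)); last by rewrite lte_fin; lra.
by apply: dHoDiag_le => //; lra.
Unshelve. all: by end_near. Qed.

(** The bound holds with any [a > dSamP S T] in place of the distance, where the
    excess of [(2 * K + 1) * a] over [2 * K * a] absorbs the strictness in the
    infima; then let [a] decrease to the distance. *)
Lemma persistent_type_lipschitz_at (K : R) (U : set (Omega R)) : 0 <= K ->
  mneighborhood (@dOmega R) v U ->
  mlipschitz_on (@dOmega R) (@dHd R N) K U
    (fun w => band S (omega_l w) (omega_u w)) ->
  mlipschitz_at (@dSamP R N) (@dHoDiag R) (2 * (K + 1)) (persistent_type v) S.
Proof.
move=> K0 [d d0 dU] lipU.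
have [vl0 vlu vu1] := omegaP v.
(* Levels of [v] moved by [2 * a] stay in [Omega] and in [U] if [4 * a < m]; the
   factor 4 also keeps the two levels in order when they move towards each
   other. *)
pose m := Num.min (Num.min d (vu - vl)) (Num.min vl (1 - vu)).
have m0 : 0 < m by rewrite !lt_min; apply/and3P; split; lra.
have [md [mv [ml mu]]] : m <= d /\ m <= vu - vl /\ m <= vl /\ m <= 1 - vu.
  by rewrite !ge_min !lexx !orbT.
have pieces T (a : R) : 0 < a -> 4 * a < m -> (dSamP S T < a%:E)%E ->
    (dHoDiag (persistent_type v S) (persistent_type v T) <=
      (2 * (K + 1) * a)%:E)%E.
  move=> a0 am ST.
  have close l u : 0 < l -> l < u -> u < 1 ->
      `|vl - l| = 2 * a -> `|vu - u| = 2 * a ->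
      (dHd (band S vl vu) (band S l u) < ((2 * K + 1) * a)%:E)%E.
    move=> l0 lu u1 vl_l vu_u.
    have w_Omega : [&& 0 < (l, u).1, (l, u).1 < (l, u).2 & (l, u).2 < 1].
      exact/and3P.
    pose w : Omega R := exist _ (l, u) w_Omega.
    have vw : dOmega v w = (2 * a)%:E.
      by rewrite /dOmega /= vl_l vu_u maxxx.
    apply: (@le_lt_trans _ _ (K%:E * dOmega v w)%E).
      apply: (lipU v w); apply: dU; last by rewrite vw lte_fin; lra.
      by rewrite /dOmega !subrr normr0 maxxx lte_fin.
    by rewrite vw -EFinM lte_fin; lra.
  have /dHd_lt[_ outer] : (dHd (band S vl vu)
      (band S (vl - 2 * a) (vu + 2 * a)) <
      ((2 * K + 1) * a)%:E)%E.
    apply: close; [lra|lra|lra| |].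
      by rewrite subKr gtr0_norm //; lra.
    by rewrite opprD addrA subrr sub0r normrN gtr0_norm //; lra.
  have /dHd_lt[inner _] : (dHd (band S vl vu)
      (band S (vl + 2 * a) (vu - 2 * a)) <
      ((2 * K + 1) * a)%:E)%E.
    apply: close; [lra|lra|lra| |].
      by rewrite opprD addrA subrr sub0r normrN gtr0_norm //; lra.
    by rewrite subKr gtr0_norm //; lra.
  have Ka0 : 0 <= (2 * K + 1) * a by rewrite mulr_ge0 //; lra.
  have [|SwT TwS] := pieces_within_close Ka0 a0 (lexx _) _ ST outer inner.
    lra.
  rewrite (_ : 2 * (K + 1) * a = (2 * K + 1) * a + a); last by ring.
  by apply: dHoDiag_le => //; exact: addr_ge0 Ka0 (ltW a0).
(* This leaves [m / 8] for the excess [y] of [a] over the distance. *)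
exists (m / 8); first lra.
move=> T ST.
have ST0 : (0 <= dSamP S T)%E by rewrite le_max dHd_ge0.
have [t ST_t] : exists t, dSamP S T = t%:E.
  exists (fine (dSamP S T)); rewrite fineK // ge0_fin_numE //.
  by apply: le_lt_trans ST _; rewrite ltry.
rewrite ST_t in ST0 ST *; rewrite lee_fin in ST; rewrite lee_fin in ST0.
apply/lee_addgt0Pr => z z0.
pose y := Num.min (m / 16) (z / (2 * (K + 1))).
have K1 : 0 < 2 * (K + 1) by lra.
have y0 : 0 < y by rewrite lt_min !divr_gt0 //; lra.
have ym : y <= m / 16 by rewrite ge_min lexx.
have yz : 2 * (K + 1) * y <= z.
  by rewrite mulrC -ler_pdivlMr // ge_min lexx orbT.
apply: (@le_trans _ _ ((2 * (K + 1) * (t + y))%:E)).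
  by apply: pieces; [lra|lra|rewrite ST_t lte_fin; lra].
rewrite -EFinM -EFinD lee_fin mulrDr; lra.
Qed.

End Main.

Theorem theorem3p38 (R : realType) (N : nat) (v : Omega R) (S : SamP R N)
  (S_compact : compact (sample S)) (S_cyl : cylindrically_stratified S) :
  mcontinuous_at (@dSamP R N) (@dHoDiag R) (persistent_type v) S /\
  (forall K : R, 0 <= K ->
    (exists2 U : set (Omega R), mneighborhood (@dOmega R) v U &
      mlipschitz_on (@dOmega R) (@dHd R N) K U
        (fun w => band S (omega_l w) (omega_u w))) ->
    mlipschitz_at (@dSamP R N) (@dHoDiag R) (2 * (K + 1)) (persistent_type v) S).
Proof.
split=> [|K K0 [U vU lipU]]; last exact: persistent_type_lipschitz_at lipU.
by case: S_cyl => _ _; exact: persistent_type_continuous_at.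
Qed.
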